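(* Let $f(x)=a_0x^n+a_1x^{n-1}+\cdots+a_n$ be a real polynomial of degree $n\ge1$ and let $M\ge2$ be an integer. Suppose that the polynomials $f_0,\ldots,f_n$ obtained by applying the generalized Euclidean algorithm with step $M$ to $f$ are all nonzero, i.e. all their leading coefficients $h_0,\ldots,h_n$ are nonzero. Then the matrix $\widetilde H_M(f)$ factors as $$\widetilde H_M(f)=J(c_1)\cdots J(c_n)\,\widetilde H_M(a_n),\qquad c_i=\frac{h_{i-1}}{h_i},\quad i=1,\ldots,n,$$ where, for a number $c$, $J(c)=(\zeta_{pq})_{p,q=1}^\infty$ is the infinite matrix with entries $$\zeta_{pq}=\begin{cases}c&\text{if }p=q=Mk+1\text{ for some integer }k\ge0,\\1&\text{if }q=p+1,\\0&\text{otherwise.}\end{cases}$$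
   Context: For a polynomial $g(x)=b_0x^d+b_1x^{d-1}+\cdots+b_d$ of degree $d$, $\widetilde H_M(g)$ is the infinite matrix $(b_{M(q-1)-(p-1)})_{p,q=1}^\infty$ (row $p$, column $q$), where $b_k:=0$ for $k<0$ and $k>d$; so its first row is $(b_0,b_M,b_{2M},\ldots)$, its second row is $(0,b_{M-1},b_{2M-1},\ldots)$, and so on. $\widetilde H_M(a_n)$ is this matrix for the constant polynomial $a_n$. Generalized Euclidean algorithm with step $M$: for $0\le j\le M-1$ put $f_j(x)=\sum_{0\le l\le n,\ l\equiv j\ (\mathrm{mod}\ M)}a_lx^{n-l}$, so $f=f_0+\cdots+f_{M-1}$. With the convention $\deg 0=-\infty$, the polynomials $f_M,\ldots,f_n$ are constructed successively for $i=0,1,\ldots,n-M$ by $f_i(x)=d_i(x)f_{i+1}(x)+f_{i+M}(x)$ with the rules: (a) if $\deg f_i\ge\deg f_{i+1}>-\infty$, then $d_i$ is the quotient and $f_{i+M}$ is the remainder in the division of $f_i$ by $f_{i+1}$; (b) if $\deg f_i<\deg f_{i+1}$, then $d_i\equiv0$ and $f_{i+M}=f_i$; (c) if $f_{i+1}\equiv 0$, then $d_i\equiv0$ and $f_{i+M}=f_i$. The algorithm stops when $f_n$ is constructed; if $n<M$ no division step is needed, since $f_0,\ldots,f_n$ are already given by the splitting of $f$. *)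

(* Defs.v *)
From HB Require Import structures.
From mathcomp Require Import all_boot all_order all_algebra.
From mathcomp Require Import boolp classical_sets cardinality fsbigop reals.

Set Implicit Arguments.
Unset Strict Implicit.
Unset Printing Implicit Defensive.

Import Order.TTheory GRing.Theory Num.Theory.
Local Open Scope ring_scope.

(* Rows and columns are numbered from 0: the entry in row p and column q of   *)
(* the usual 1-based convention is the value at (p - 1, q - 1).               *)
Definition infmx (R : Type) := nat -> nat -> R.

Definition infmx1 (R : pzRingType) : infmx R := fun p q => (p == q)%:R.

(* The sum over r is a finite-support sum, and is 0 by convention when the    *)
(* support is infinite; it is the genuine row-by-column product as soon as    *)
(* every row of A has finitely many nonzero entries.                          *)
Definition infmx_mul (R : realType) (A B : infmx R) : infmx R :=
  fun p q => \sum_(r \in [set: nat]%classic) A p r * B r q.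

(* The coefficient b_k of g = b_0 x^d + b_1 x^(d-1) + ... + b_d, d = deg g,   *)
(* extended by b_k = 0 for k < 0 and k > d.                                   *)
Definition dcoef (R : realType) (g : {poly R}) (k : int) : R :=
  match k with
  | Posz m => if (m < size g)%N then g`_((size g).-1 - m) else 0
  | Negz _ => 0
  end.

Definition hurwitz_mx (R : realType) (M : nat) (g : {poly R}) : infmx R :=
  fun p q => dcoef g (M%:Z * q%:Z - p%:Z).

Definition jmx (R : realType) (M : nat) (c : R) : infmx R :=
  fun p q =>
    if (p == q) && (M %| p)%N then c
    else if q == p.+1 then 1
    else 0.

Definition split_poly (R : realType) (M n : nat) (f : {poly R}) (j : nat) :
    {poly R} :=
  \sum_(0 <= l < n.+1 | l == j %[mod M]) dcoef f l%:Z *: 'X^(n - l).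

(* One step p = d * q + r; since size 0 = 0, comparing sizes amounts to       *)
(* comparing degrees with deg 0 = -oo.                                        *)
Variant euclid_step (R : realType) (p q d r : {poly R}) : Prop :=
  | EuclidDiv of q != 0 & (size q <= size p)%N & d = p %/ q & r = p %% q
  | EuclidSkip of (size p < size q)%N & d = 0 & r = p
  | EuclidZero of q = 0 & d = 0 & r = p.

(* F 0, ..., F n are the polynomials, and d 0, ..., d (n - M) the quotients,  *)
(* produced from f of degree n; when n < M there is no division step.         *)
(* The values of F beyond max(n, M - 1) are irrelevant.                       *)
Definition gen_euclid (R : realType) (M n : nat) (f : {poly R})
    (F d : nat -> {poly R}) : Prop :=
  (forall j, (j < M)%N -> F j = split_poly M n f j) /\
  (forall i, (i + M <= n)%N -> euclid_step (F i) (F i.+1) (d i) (F (i + M)%N)).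

(* Main.v *)
Require Import Defs.
From HB Require Import structures.
From mathcomp Require Import all_boot all_order all_algebra.
From mathcomp Require Import boolp classical_sets cardinality fsbigop reals.
From mathcomp Require Import zify.

Set Implicit Arguments.
Unset Strict Implicit.
Unset Printing Implicit Defensive.

Import Order.TTheory GRing.Theory Num.Theory.
Local Open Scope ring_scope.

(** Multiplying on the left by J(c) replaces row p of a matrix by row p + 1
    plus, when M divides p, c times row p.  On Hurwitz matrices this is the
    passage from g' to g = g' + c x u, where u is the part of g' whose exponents
    are congruent to deg g' mod M and deg g = deg g' + 1
    ([hurwitz_mx_step]).

    The Euclidean algorithm provides a chain of such passages.  Write n for the
    degree of f.  Each f_i has all its exponents in the class of n - i mod M,
    since the splitting of f has this property and remainders inherit it
    ([class_supp_modp]).  Together with the nonvanishing of f_0, ..., f_n this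
    forces deg f_i = n - i ([gen_euclid_size]): degrees within a class jump by
    multiples of M, so a defect in the degree of some f_i, i >= 1, propagates
    to f_(i-1+M), and so on until the degree would have to be negative.
    Consequently every quotient is the monomial c_(i+1) x and
      f_i = c_(i+1) x f_(i+1) + f_(i+M),
    where f_j := 0 for j > n ([gen_euclid_rec]).

    Put g_k = f_k + ... + f_(k+M-1) ([window_sum]).  The recurrence says that
    g_k = g_(k+1) + c_(k+1) x f_(k+1), and f_(k+1) is the part of g_(k+1) in the
    class of its degree, so that H(g_k) = J(c_(k+1)) H(g_(k+1)).  The chain
    starts at g_0 = f and ends at the constant g_n, whose value is a_n because
    g_k(0) does not depend on k.  Multiplying the n identities together requires
    associativity, which holds here because every matrix to the left of another
    one is row-finite ([jmx_mulA]). *)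

(** * Products of row-finite infinite matrices *)

Definition row_finite (R : realType) (A : infmx R) :=
  forall p, exists N, forall r, (N <= r)%N -> A p r = 0.

Lemma infmx_mulE (R : realType) (N : nat) (A B : infmx R) p q :
  (forall r, (N <= r)%N -> A p r = 0) ->
  infmx_mul A B p q = \sum_(0 <= r < N) A p r * B r q.
Proof.
move=> A0; rewrite /infmx_mul (fsbigE (index_iota 0 N)) //=.
- by apply: eq_bigl => r; rewrite in_setT.
- by rewrite iota_uniq.
- by move=> r _; rewrite mem_index_iota /= -leqNgt => /A0 ->; rewrite mul0r.
Qed.

Lemma mul_infmx1 (R : realType) (B : infmx R) : infmx_mul (@infmx1 R) B = B.
Proof.
apply/funext => p; apply/funext => q; rewrite (@infmx_mulE _ p.+1); last first.
  by move=> r lt_pr; rewrite /infmx1 ltn_eqF.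
rewrite big_nat_recr //= /infmx1 eqxx mul1r big_nat big1 ?add0r // => r /= lt_rp.
by rewrite gtn_eqF // mul0r.
Qed.

Lemma jmx_mulE (R : realType) M (c : R) (B : infmx R) p q :
  infmx_mul (jmx M c) B p q =
  (if (M %| p)%N then c else 0) * B p q + B p.+1 q.
Proof.
rewrite (@infmx_mulE _ p.+2); last first.
  by move=> r lt_pr; rewrite /jmx ltn_eqF ?gtn_eqF //= ltnW.
rewrite !big_nat_recr //= big_nat big1 => [|r /= lt_rp]; last first.
  by rewrite /jmx gtn_eqF // ltn_eqF ?mul0r // ltnW.
by rewrite add0r /jmx !eqxx /= (ltn_eqF (ltnSn p)) mul1r.
Qed.

Lemma row_finite_jmx_mul (R : realType) M (c : R) (B : infmx R) :
  row_finite B -> row_finite (infmx_mul (jmx M c) B).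
Proof.
move=> finB p; have [N1 B1] := finB p; have [N2 B2] := finB p.+1.
exists (maxn N1 N2) => r; rewrite geq_max => /andP[/B1 B1r /B2 B2r].
by rewrite jmx_mulE B1r B2r mulr0 addr0.
Qed.

(** Associativity can fail for the finite-support product in general; row
    finiteness of B lets both sides be computed by sums over a common finite
    range, whatever C is. *)
Lemma jmx_mulA (R : realType) M (c : R) (B C : infmx R) : row_finite B ->
  infmx_mul (infmx_mul (jmx M c) B) C = infmx_mul (jmx M c) (infmx_mul B C).
Proof.
move=> finB; apply/funext => p; apply/funext => q.
have [N1 B1] := finB p; have [N2 B2] := finB p.+1.
have B1N r : (maxn N1 N2 <= r)%N -> B p r = 0.
  by rewrite geq_max => /andP[/B1].
have B2N r : (maxn N1 N2 <= r)%N -> B p.+1 r = 0.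
  by rewrite geq_max => /andP[_ /B2].
rewrite jmx_mulE !(@infmx_mulE _ (maxn N1 N2)) //; last first.
  by move=> r leNr; rewrite jmx_mulE B1N // B2N // mulr0 addr0.
rewrite mulr_sumr -big_split /=; apply: eq_bigr => r _.
by rewrite jmx_mulE mulrDl mulrA.
Qed.

Lemma row_finite_bigjmx (R : realType) M (c : nat -> R) m n :
  row_finite (\big[@infmx_mul R / @infmx1 R]_(m <= i < n) jmx M (c i)).
Proof.
elim: {m n}(index_iota m n) => [|i s IHs].
  by rewrite big_nil => p; exists p.+1 => r lt_pr; rewrite /infmx1 ltn_eqF.
by rewrite big_cons; apply: row_finite_jmx_mul.
Qed.

(** * Splitting one factor off a Hurwitz matrix *)

Lemma dcoefE (R : realType) (g : {poly R}) s m : size g = s.+1 ->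
  dcoef g (Posz m) = if (m <= s)%N then g`_(s - m) else 0.
Proof. by move=> sz_g; rewrite /dcoef sz_g ltnS. Qed.

(** With m = M q - p, the entry (p, q) of the Hurwitz matrix is the coefficient
    of index m counted from the top.  The degree of g exceeds that of g' by 1,
    so g' contributes its coefficient of index m - 1, which is the entry
    (p + 1, q) of its matrix; c x u contributes c times the coefficient of
    index m in u, which is that of g' when M divides m, equivalently p, and 0
    otherwise. *)
Lemma hurwitz_mx_step (R : realType) M s (c : R) (g g' u : {poly R}) :
    size g = s.+2 -> size g' = s.+1 -> g = g' + c *: ('X * u) ->
    (forall e, (e <= s)%N -> u`_e = if (M %| s - e)%N then g'`_e else 0) ->
  hurwitz_mx M g = infmx_mul (jmx M c) (hurwitz_mx M g').
Proof.
move=> sz_g sz_g' def_g def_u; apply/funext => p; apply/funext => q.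
rewrite jmx_mulE /hurwitz_mx.
have [lt_qp | le_pq] := ltnP (M * q) p.
  have neg k : (M * q < k)%N -> M%:Z * q%:Z - k%:Z = Negz (k - M * q).-1 by lia.
  by rewrite !neg ?leqW //= mulr0 addr0.
have -> : M%:Z * q%:Z - p%:Z = Posz (M * q - p) by lia.
rewrite (dcoefE _ sz_g) (dcoefE _ sz_g').
have -> : (M %| p)%N = (M %| M * q - p)%N.
  by rewrite dvdn_subr // dvdn_mulr.
case def_m: (M * q - p)%N => [|m].
  (* Top coefficient: only x u reaches the degree of g. *)
  have -> : M%:Z * q%:Z - p.+1%:Z = Negz 0 by lia.
  rewrite /= addr0 !subn0 dvdn0 def_g coefD coefZ coefXM /= def_u //.
  by rewrite subnn dvdn0 nth_default ?sz_g' // add0r.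
have -> : M%:Z * q%:Z - p.+1%:Z = Posz m by lia.
rewrite (dcoefE _ sz_g') ltnS subSS.
have [le_ms | lt_sm] := leqP m s; last first.
  by rewrite ltnNge ltnW //= mulr0 addr0.
rewrite def_g coefD coefZ coefXM addrC; congr (_ + _).
move: le_ms; rewrite leq_eqVlt => /orP[/eqP-> | lt_ms].
  (* Constant coefficient: x u has none. *)
  by rewrite subnn ltnn !mulr0.
rewrite lt_ms ifN ?subn_eq0 -?ltnNge // def_u; last by lia.
have -> : (s - (s - m).-1 = m.+1)%N by lia.
have -> : ((s - m).-1 = s - m.+1)%N by lia.
by case: ifP; rewrite ?mulr0 ?mul0r.
Qed.

(** * Polynomials supported on one residue class of exponents *)

Definition class_supp (R : nzRingType) (M s : nat) (p : {poly R}) :=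
  forall e, p`_e != 0 -> e = s %[mod M].

(** All degree estimates below gain a full M through this jump, which is what
    makes strict inequalities between degrees so rigid. *)
Lemma eqmod_gap M a b : a = b %[mod M] -> (a < b)%N -> (a + M <= b)%N.
Proof.
move=> /esym/eqP eq_ab lt_ab; move: eq_ab; rewrite eqn_mod_dvd; last exact: ltnW.
by move=> /dvdn_leq; rewrite subn_gt0 => /(_ lt_ab); lia.
Qed.

Lemma class_suppB (R : nzRingType) M s (p q : {poly R}) :
  class_supp M s p -> class_supp M s q -> class_supp M s (p - q).
Proof.
move=> supp_p supp_q e; rewrite coefB.
have [q0 | /supp_q //] := eqVneq q`_e 0.
by rewrite q0 subr0 => /supp_p.
Qed.

Lemma class_supp_shift (R : nzRingType) M s t k (c : R) (q : {poly R}) :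
  class_supp M t q -> (t + k)%N = s %[mod M] ->
  class_supp M s (c *: ('X^k * q)).
Proof.
move=> supp_q eq_s e; rewrite coefZ coefXnM.
case: ltnP => [_ | le_ke]; first by rewrite mulr0 eqxx.
have [-> | /supp_q eq_e _] := eqVneq q`_(e - k) 0; first by rewrite mulr0 eqxx.
by apply/eqP; rewrite -eq_s -(subnK le_ke) eqn_modDr; apply/eqP.
Qed.

Lemma class_supp_size (R : nzRingType) M s (p : {poly R}) :
  class_supp M s p -> p != 0 -> (size p).-1 = s %[mod M].
Proof. by move=> supp_p p0; apply: supp_p; rewrite -lead_coefE lead_coef_eq0. Qed.

Lemma class_supp_size_gap (R : nzRingType) M s (p : {poly R}) :
  class_supp M s p -> (size p <= s)%N -> p != 0 -> (size p + M <= s.+1)%N.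
Proof.
move=> supp_p le_ps p0; have sz_p : (0 < size p)%N by rewrite size_poly_gt0.
by have := eqmod_gap (class_supp_size supp_p p0); lia.
Qed.

(** In long division each step subtracts c x^k q with k the difference of the
    degrees, and this shifts the class of q exactly onto the class of p. *)
Lemma class_supp_modp (R : fieldType) M s t (p q : {poly R}) :
  class_supp M s p -> class_supp M t q -> class_supp M s (p %% q).
Proof.
move=> supp_p supp_q; have [-> | q0] := eqVneq q 0; first by rewrite modp0.
move: {2}(size p) (leqnn (size p)) => N; elim: N p supp_p => [|N IHN] p supp_p.
  by rewrite leqn0 size_poly_eq0 => /eqP->; rewrite mod0p => e; rewrite coef0 eqxx.
move=> le_pN; have [lt_pq | le_qp] := ltnP (size p) (size q).
  by rewrite modp_small.
have sz_q : (0 < size q)%N by rewrite size_poly_gt0.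
have p0 : p != 0 by rewrite -size_poly_gt0 (leq_trans sz_q).
have [k def_k] : exists k, (k + size q)%N = size p.
  by exists (size p - size q)%N; rewrite subnK.
have eq_k : ((size q).-1 + k)%N = (size p).-1 by lia.
set c := lead_coef p / lead_coef q.
have -> : p %% q = (p - c *: ('X^k * q)) %% q.
  by rewrite modpD modpN modpZl modp_mull scaler0 subr0.
apply: IHN.
  apply: class_suppB => //; apply: (class_supp_shift supp_q).
  rewrite -(class_supp_size supp_p p0) -modnDml -(class_supp_size supp_q q0).
  by rewrite modnDml eq_k.
apply/leq_sizeP => j le_Nj; rewrite coefB coefZ coefXnM.
rewrite ifN; last by lia.
have [lt_jp | le_pj] := ltnP j (size p); last first.
  have le_qj : (size q <= j - k)%N by lia.
  by rewrite (nth_default _ le_pj) (nth_default _ le_qj) mulr0 subr0.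
have -> : j = (size p).-1 by lia.
have -> : ((size p).-1 - k = (size q).-1)%N by lia.
by rewrite -!lead_coefE divfK ?subrr // lead_coef_eq0.
Qed.

(** * Degrees in the generalized Euclidean algorithm *)

Lemma coef_split_poly (R : realType) M n (f : {poly R}) j e :
  size f = n.+1 ->
  (split_poly M n f j)`_e =
  if (e <= n)%N && (n - e == j %[mod M])%N then f`_e else 0.
Proof.
move=> sz_f; rewrite /split_poly coef_sum big_mkcond big_mkord.
have [le_en | lt_ne] /= := leqP e n; last first.
  rewrite big1 // => l _; rewrite coefZ coefXn.
  have -> : (e == n - l)%N = false by lia.
  by rewrite mulr0 if_same.
rewrite (bigD1 (inord (n - e))) //= inordK ?ltnS ?leq_subr // big1 => [|l ne_l].
  by rewrite sz_f ltnS leq_subr subKn // addr0 coefZ coefXn eqxx mulr1.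
rewrite coefZ coefXn; have [def_e|_] := eqVneq e (n - l)%N; last by rewrite mulr0 if_same.
case/eqP: ne_l; apply: val_inj; rewrite /= inordK; last by rewrite ltnS leq_subr.
by have := ltn_ord l; lia.
Qed.

Lemma gen_euclid_supp (R : realType) M n (f : {poly R}) F d :
    (2 <= M)%N -> size f = n.+1 -> gen_euclid M n f F d ->
  forall i, (i <= n)%N -> class_supp M (n - i) (F i).
Proof.
move=> M_gt1 sz_f [F_init F_step] i.
elim/ltn_ind: i => i IHi le_in; have [lt_iM | le_Mi] := ltnP i M.
  rewrite F_init // => e; rewrite coef_split_poly //.
  case: ifP; rewrite ?eqxx // => /andP[le_en /eqP eq_ei] _.
  apply/eqP; rewrite -(eqn_modDr (n - e)) subnKC //.
  by rewrite -modnDmr eq_ei modnDmr subnK.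
have le_n : (i - M + M <= n)%N by rewrite subnK.
have supp_r : class_supp M (n - i) (F (i - M)%N).
  move=> e e0; rewrite (IHi (i - M)%N _ _ e e0); try lia.
  by rewrite subnBA // -addnBAC // modnDr.
have := F_step _ le_n; rewrite subnK // => -[q0 _ _ -> | _ _ -> | _ _ ->] //.
by apply: class_supp_modp supp_r (IHi _ _ _); lia.
Qed.

Lemma gen_euclid_size_lt (R : realType) M n (f : {poly R}) F d :
    gen_euclid M n f F d ->
  forall i, (i + M <= n)%N -> F i.+1 != 0 -> (size (F (i + M)%N) < size (F i.+1))%N.
Proof.
move=> [_ F_step] i le_n Fi1; case: (F_step i le_n) => [_ _ _ -> | lt_F _ -> | F0] //.
  by rewrite ltn_modp.
by rewrite F0 eqxx in Fi1.
Qed.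

(** For i >= M the degree of f_i is below that of f_(i-M+1), hence below
    n - (i - M); being in the class of n - i it drops by M at once. *)
Lemma gen_euclid_size_le (R : realType) M n (f : {poly R}) F d :
    (2 <= M)%N -> size f = n.+1 -> gen_euclid M n f F d ->
    (forall i, (i <= n)%N -> F i != 0) ->
  forall i, (i <= n)%N -> (size (F i) <= (n - i).+1)%N.
Proof.
move=> M_gt1 sz_f eucl F0 i.
elim/ltn_ind: i => i IHi le_in; have [lt_iM | le_Mi] := ltnP i M.
  case: (eucl) => F_init _; rewrite F_init //; apply/leq_sizeP => e lt_e.
  rewrite coef_split_poly //; case: ifP => // /andP[le_en /eqP eq_ei].
  by have := eqmod_gap eq_ei; lia.
have le_n : (i - M + M <= n)%N by rewrite subnK.
have Fi1 : F (i - M).+1 != 0 by apply: F0; lia.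
have := gen_euclid_size_lt eucl le_n Fi1; rewrite subnK // => lt_F.
have le_F := IHi (i - M).+1 ltac:(lia) ltac:(lia).
have supp_i := gen_euclid_supp M_gt1 sz_f eucl le_in.
have [le_s | lt_s] := leqP (size (F i)) (n - i).+1; first by [].
have eq_s : (n - i)%N = (size (F i)).-1 %[mod M].
  exact/esym/(class_supp_size supp_i (F0 i le_in)).
by have := eqmod_gap eq_s; lia.
Qed.

(** If deg f_(i+1) < n - (i+1), then deg f_(i+1) <= n - (i+1) - M by the class
    constraint.  In particular i + M <= n, so that the nonzero polynomial
    f_(i+M) exists and has smaller degree than f_(i+1); but by induction its
    degree is already n - (i + M) = n - (i+1) - (M - 1). For f_0 the leading
    coefficient of f decides. *)
Lemma gen_euclid_size (R : realType) M n (f : {poly R}) F d :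
    (2 <= M)%N -> size f = n.+1 -> gen_euclid M n f F d ->
    (forall i, (i <= n)%N -> F i != 0) ->
  forall i, (i <= n)%N -> size (F i) = (n - i).+1.
Proof.
move=> M_gt1 sz_f eucl F0 i le_in.
have le_F := gen_euclid_size_le M_gt1 sz_f eucl F0.
have [m] := ubnP (n - i); elim: m i le_in => // m IHm i le_in lt_m.
apply/eqP; rewrite eqn_leq le_F //=.
case: i => [|i] in le_in lt_m *.
  case: (eucl) => F_init _; rewrite F_init; last exact: ltnW.
  rewrite subn0 ltnNge; apply/negP => /leq_sizeP/(_ n (leqnn n))/eqP.
  rewrite coef_split_poly // leqnn subnn eqxx /= -[n in f`_n]/(n.+1.-1) -sz_f.
  by rewrite -lead_coefE lead_coef_eq0 -size_poly_eq0 sz_f.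
rewrite ltnNge; apply/negP => lt_F.
have supp_i := gen_euclid_supp M_gt1 sz_f eucl le_in.
have gap : (size (F i.+1) + M <= (n - i.+1).+1)%N.
  exact: class_supp_size_gap supp_i lt_F (F0 _ le_in).
have sz_gt0 : (0 < size (F i.+1))%N by rewrite size_poly_gt0 F0.
have le_n : (i + M <= n)%N by lia.
have := gen_euclid_size_lt eucl le_n (F0 _ le_in).
by rewrite IHm //; lia.
Qed.

(** The candidate remainder r = f_i - c x f_(i+1) has degree below n - i and
    lies in the class of n - i, so its degree is at most n - i - M, less than
    deg f_(i+1): uniqueness of division identifies it with f_(i+M).  For the
    last indices, where i + M > n, the same bound is negative and r = 0. *)
Lemma gen_euclid_rec (R : realType) M n (f : {poly R}) F d :
    (2 <= M)%N -> size f = n.+1 -> gen_euclid M n f F d ->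
    (forall i, (i <= n)%N -> F i != 0) ->
  forall i, (i < n)%N ->
  F i = (lead_coef (F i) / lead_coef (F i.+1)) *: ('X * F i.+1) +
        (if (i + M <= n)%N then F (i + M)%N else 0).
Proof.
move=> M_gt1 sz_f eucl F0 i lt_in.
have sz_i := gen_euclid_size M_gt1 sz_f eucl F0 (ltnW lt_in).
have sz_i1 := gen_euclid_size M_gt1 sz_f eucl F0 lt_in.
have supp_i := gen_euclid_supp M_gt1 sz_f eucl (ltnW lt_in).
have supp_i1 := gen_euclid_supp M_gt1 sz_f eucl lt_in.
have lc0 : lead_coef (F i.+1) != 0 by rewrite lead_coef_eq0 F0.
set c := _ / _; have [r def_r] : exists r, r = F i - c *: ('X * F i.+1) by eexists.
have supp_r : class_supp M (n - i) r.
  rewrite def_r; apply: class_suppB => //; rewrite -['X]expr1.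
  by apply: (class_supp_shift supp_i1); congr (_ %% _)%N; lia.
have le_r : (size r <= n - i)%N.
  apply/leq_sizeP => j le_j; rewrite def_r coefB coefZ coefXM ifN; last by lia.
  move: le_j; rewrite leq_eqVlt => /orP[/eqP <- | lt_j].
    (* c is chosen to cancel the coefficient of degree n - i. *)
    rewrite [X in X - _](_ : _ = lead_coef (F i)); last by rewrite lead_coefE sz_i.
    rewrite [X in _ * X](_ : _ = lead_coef (F i.+1)) ?divfK ?subrr //.
    by rewrite lead_coefE sz_i1; congr (_`_ _); lia.
  rewrite nth_default ?sz_i // nth_default ?mulr0 ?subr0 // sz_i1; lia.
suff -> : (if (i + M <= n)%N then F (i + M)%N else 0) = r by rewrite def_r addrC subrK.
have gap_r : r != 0 -> (size r + M <= (n - i).+1)%N.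
  exact: class_supp_size_gap supp_r le_r.
case: ifPn => [le_n | gt_n]; last first.
  have [//|r0] := eqVneq r 0; have gap := gap_r r0; exfalso.
  by have : (0 < size r)%N; [rewrite size_poly_gt0 | lia].
case: (eucl) => _ /(_ i le_n) [_ _ _ -> | | F0i]; last 2 first.
- by rewrite sz_i sz_i1; lia.
- by rewrite F0i lead_coef0 eqxx in lc0.
have lt_r : (size r < (n - i.+1).+1)%N.
  by have [->|/gap_r] := eqVneq r 0; [rewrite size_poly0 | lia].
apply/esym/(@modpP _ _ (c *: 'X)); first by rewrite def_r -scalerAl addrC subrK.
by rewrite sz_i1.
Qed.

(** * The window sums and the telescoping product *)

(** The condition on j extends the family by F i = 0 for i > n, whatever values
    F takes there. *)
Definition window_sum (R : nzRingType) (M n : nat) (F : nat -> {poly R}) k :=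
  \sum_(j < M | (k + j <= n)%N) F (k + j)%N.

Lemma window_sum_rec (R : nzRingType) M n (F : nat -> {poly R}) k g :
    (k < n)%N -> F k = g + (if (k + M <= n)%N then F (k + M)%N else 0) ->
  window_sum M n F k = window_sum M n F k.+1 + g.
Proof.
move=> lt_kn defF; rewrite /window_sum.
apply: (addIr (if (k + M <= n)%N then F (k + M)%N else 0)).
rewrite -addrA -defF big_mkcond.
rewrite -(big_ord_recr _ (fun j => if (k + j <= n)%N then F (k + j)%N else 0)).
rewrite big_ord_recl addn0 ltnW // addrC; congr (_ + _).
by rewrite [RHS]big_mkcond; apply: eq_bigr => j _; rewrite /= -addSnnS.
Qed.

Lemma window_sum0 (R : realType) M n (f : {poly R}) F d :
    (0 < M)%N -> size f = n.+1 -> gen_euclid M n f F d ->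
  window_sum M n F 0 = f.
Proof.
move=> M_gt0 sz_f [F_init _]; apply/polyP => e; rewrite /window_sum coef_sum.
have [le_en | lt_ne] := leqP e n; last first.
  rewrite [RHS]nth_default ?sz_f // big1 // => j _.
  by rewrite add0n F_init // coef_split_poly // leqNgt lt_ne.
have lt_jM := ltn_pmod (n - e) M_gt0.
rewrite (bigD1 (Ordinal lt_jM)) /=; last first.
  by rewrite add0n (leq_trans (leq_mod _ _)) // leq_subr.
rewrite add0n F_init // coef_split_poly // le_en modn_mod eqxx big1 ?addr0 //.
move=> j /andP[_ ne_j]; rewrite add0n F_init // coef_split_poly // le_en /=.
rewrite (modn_small (ltn_ord j)); case: eqVneq => // eq_j.
by case/eqP: ne_j; apply: val_inj.
Qed.

(** The M summands have pairwise distinct exponent classes, so the class of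
    n - k only sees the summand F k. *)
Lemma coef_window_sum (R : nzRingType) M n (F : nat -> {poly R}) k e :
    (0 < M)%N -> (k <= n)%N ->
    (forall i, (i <= n)%N -> class_supp M (n - i) (F i)) -> e = (n - k)%N %[mod M] ->
  (window_sum M n F k)`_e = (F k)`_e.
Proof.
move=> M_gt0 le_kn supp eq_e; rewrite /window_sum coef_sum.
rewrite (bigD1 (Ordinal M_gt0)) /= addn0 // big1 ?addr0 // => j /andP[le_kj ne_j].
apply: contraNeq ne_j => /(supp _ le_kj); rewrite eq_e => /esym/eqmod_gap gap.
by apply/eqP/val_inj => /=; have := ltn_ord j; lia.
Qed.

Lemma size_window_sum (R : nzRingType) M n (F : nat -> {poly R}) k :
    (0 < M)%N -> (k <= n)%N ->
    (forall i, (i <= n)%N -> size (F i) = (n - i).+1) ->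
  size (window_sum M n F k) = (n - k).+1.
Proof.
move=> M_gt0 le_kn szF; rewrite /window_sum (bigD1 (Ordinal M_gt0)) /= addn0 //.
rewrite size_polyDl ?szF // ltnS; apply: (leq_trans (size_sum _ _ _)).
apply/bigmax_leqP => j /andP[le_kj]; rewrite -val_eqE /= => ne_j.
by rewrite szF //; lia.
Qed.

Theorem theorem30 (R : realType) (M n : nat) (f : {poly R})
    (F d : nat -> {poly R})
    (hM : (2 <= M)%N) (hn : (1 <= n)%N) (hf : size f = n.+1)
    (hF : gen_euclid M n f F d)
    (hF0 : forall i, (i <= n)%N -> F i != 0) :
  hurwitz_mx M f =
  infmx_mul
    (\big[@infmx_mul R / @infmx1 R]_(1 <= i < n.+1)
       jmx M (lead_coef (F i.-1) / lead_coef (F i)))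
    (hurwitz_mx M (dcoef f n%:Z)%:P).
Proof.
have M_gt0 : (0 < M)%N := ltnW hM.
have szF := gen_euclid_size hM hf hF hF0.
have suppF := gen_euclid_supp hM hf hF.
pose c k := lead_coef (F k.-1) / lead_coef (F k).
pose g := window_sum M n F.
have g_rec k : (k < n)%N -> g k = g k.+1 + c k.+1 *: ('X * F k.+1).
  by move=> lt_kn; apply/window_sum_rec/(gen_euclid_rec hM hf hF hF0).
have sz_g k : (k <= n)%N -> size (g k) = (n - k).+1.
  by move=> le_kn; apply: size_window_sum.
have g0 : g 0%N = f by apply: window_sum0 hF.
have g_const k : (k <= n)%N -> (g k)`_0 = f`_0.
  elim: k => [|k IHk] lt_kn; first by rewrite g0.
  by rewrite -IHk ?(ltnW lt_kn) // (g_rec _ lt_kn) coefD coefZ coefXM mulr0 addr0.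
have gn : g n = (dcoef f n%:Z)%:P.
  rewrite (dcoefE _ hf) leqnn subnn -(g_const n) //.
  by apply: size1_polyC; rewrite sz_g // subnn.
have H_step k : (k < n)%N ->
    hurwitz_mx M (g k) = infmx_mul (jmx M (c k.+1)) (hurwitz_mx M (g k.+1)).
  move=> lt_kn; apply: (@hurwitz_mx_step _ _ (n - k.+1) _ _ _ (F k.+1)).
  - by rewrite subnSK // sz_g // ltnW.
  - by rewrite sz_g.
  - exact: g_rec.
  move=> e le_e; rewrite -eqn_mod_dvd // eq_sym; case: eqP => [eq_e | ne_e].
    by rewrite /g coef_window_sum.
  by apply: contra_notP ne_e => /eqP; apply: suppF.
suff telescope m k : (k + m)%N = n -> hurwitz_mx M (g k) =
    infmx_mul (\big[@infmx_mul R / @infmx1 R]_(k.+1 <= i < n.+1) jmx M (c i))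
      (hurwitz_mx M (g n)).
  by rewrite -gn -g0; exact: telescope (add0n n).
elim: m k => [|m IHm] k def_n.
  by rewrite -def_n addn0 big_geq // mul_infmx1.
have lt_kn : (k < n)%N by lia.
rewrite big_ltn // jmx_mulA; last exact: row_finite_bigjmx.
by rewrite (H_step k lt_kn) (IHm k.+1) // addSnnS.
Qed.
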